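(* Let $n\ge 2$ and let $\triangle\subset\mathbb{R}^{n-1}$ be a non-degenerate simplex with $n$ vertices and inradius $r$, and let $k\in[n]$. Then every closed Euclidean ball that intersects the affine span of each $(k-1)$-dimensional face of $\triangle$ has radius at least $\lambda_n r$, where \[ \lambda_n=\sqrt{\frac{(n-1)(n-k)}{k}}. \]
   Context: A $(k-1)$-dimensional face of $\triangle$ is the convex hull of $k$ of its vertices. The inradius is the radius of the largest ball contained in $\triangle$. *)

(* Defs.v *)
From HB Require Import structures.
From mathcomp Require Import all_boot all_order all_algebra.
From mathcomp Require Import reals.
Set Implicit Arguments. Unset Strict Implicit. Unset Printing Implicit Defensive.
Import Order.TTheory GRing.Theory Num.Theory.
Local Open Scope ring_scope.

Definition edist (R : realType) (d : nat) (x y : 'rV[R]_d) : R :=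
  Num.sqrt (\sum_(j < d) (x 0 j - y 0 j) ^+ 2).

Definition cball (R : realType) (d : nat) (c : 'rV[R]_d) (rho : R) :
  'rV[R]_d -> Prop := fun y => edist c y <= rho.

Definition aff_indep (R : realType) (d n : nat) (v : 'I_n -> 'rV[R]_d) : Prop :=
  forall a : 'I_n -> R,
    \sum_(i < n) a i = 0 -> \sum_(i < n) a i *: v i = 0 -> forall i, a i = 0.

Definition simplex (R : realType) (d n : nat) (v : 'I_n -> 'rV[R]_d) :
  'rV[R]_d -> Prop :=
  fun x => exists a : 'I_n -> R,
    (forall i, 0 <= a i) /\ \sum_(i < n) a i = 1 /\ x = \sum_(i < n) a i *: v i.

Definition aff_span (R : realType) (d n : nat) (v : 'I_n -> 'rV[R]_d)
  (S : {set 'I_n}) : 'rV[R]_d -> Prop :=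
  fun x => exists a : 'I_n -> R,
    (forall i, i \notin S -> a i = 0) /\ \sum_(i < n) a i = 1 /\
    x = \sum_(i < n) a i *: v i.

Definition is_inradius (R : realType) (d n : nat) (v : 'I_n -> 'rV[R]_d) (r : R) : Prop :=
  (exists c, forall y, cball c r y -> simplex v y) /\
  (forall c rho, (forall y, cball c rho y -> simplex v y) -> rho <= r).

(* Main.v *)
(** Let [a_i(y) = b_i + g_i . (y - c)] be the barycentric coordinates of the simplex, so that
    [sum b_i = 1] and [sum g_i = 0].  A ball of radius [r] inside the simplex gives
    [r * sum |g_i| <= 1].  Put [m = n - k].  A ball of centre [c] and radius [rho] meets the
    face spans exactly when all principal [m * m] submatrices of the Gram-like matrix
    [N i j = rho^2 g_i . g_j - b_i b_j] are positive semidefinite, while the sum of all the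
    entries of [N] is [-1].  A symmetric matrix with unit diagonal and positive semidefinite
    [m * m] principal submatrices satisfies
    [n (m - 1) (p Q p^T) >= - (n - m) (sum p_i)^2] for [p >= 0]; applied to the rescaling
    of [N] to unit diagonal, with [p_i = sqrt (N i i)], it bounds [sum sqrt (N i i)] from
    below, and Minkowski's inequality bounds it from above by [sqrt (rho^2 (sum |g_i|)^2 - 1)]. *)

Require Import Defs.
From HB Require Import structures.
From mathcomp Require Import all_boot all_order all_algebra.
From mathcomp Require Import reals boolp classical_sets topology normedtype derive.
From mathcomp Require Import ring lra.
Import Order.TTheory GRing.Theory Num.Theory.
Import numFieldNormedType.Exports.
Local Open Scope ring_scope.

(** * Cones over faces, quadratic forms and their minima *)

(** The cone over a face of the standard simplex: leaving the coordinate sum free makes it stable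
    under sums and nonnegative scaling. *)
Definition in_face {R : realType} {n : nat} (A : {set 'I_n}) (p : 'rV[R]_n) : Prop :=
  (forall i, 0 <= p 0 i) /\ (forall i, i \notin A -> p 0 i = 0).

Lemma in_faceD (R : realType) n (A : {set 'I_n}) (p q : 'rV[R]_n) :
  in_face A p -> in_face A q -> in_face A (p + q).
Proof.
move=> [p0 pA] [q0 qA]; split=> i; rewrite mxE; first exact: addr_ge0.
by move=> iA; rewrite pA // qA // addr0.
Qed.

Lemma in_faceZ (R : realType) n (A : {set 'I_n}) a (p : 'rV[R]_n) :
  0 <= a -> in_face A p -> in_face A (a *: p).
Proof.
move=> a0 [p0 pA]; split=> i; rewrite mxE; first exact: mulr_ge0.
by move=> iA; rewrite pA // mulr0.
Qed.

Lemma in_face_delta (R : realType) n (A : {set 'I_n}) j :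
  j \in A -> in_face A (delta_mx 0 j : 'rV[R]_n).
Proof.
move=> jA; split=> i; rewrite mxE eqxx /=; first exact: ler0n.
by case: eqP => [->|//]; rewrite jA.
Qed.

Lemma sum_delta (R : realType) n (j : 'I_n) :
  \sum_i (delta_mx 0 j : 'rV[R]_n) 0 i = 1.
Proof.
rewrite (bigD1 j) //= big1 ?addr0 ?mxE ?eqxx //.
by move=> i /negbTE ij; rewrite mxE ij andbF.
Qed.

Definition bilin {R : realType} {n : nat} (Q : 'M[R]_n) (x y : 'rV[R]_n) : R :=
  (x *m Q *m y^T) 0 0.

Lemma bilinE (R : realType) n (Q : 'M[R]_n) x y :
  bilin Q x y = \sum_i \sum_j x 0 i * y 0 j * Q i j.
Proof.
rewrite /bilin !mxE exchange_big /=; apply: eq_bigr => j _.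
rewrite !mxE mulr_suml; apply: eq_bigr => i _; by rewrite mulrAC.
Qed.

Lemma bilinDl (R : realType) n (Q : 'M[R]_n) x y z :
  bilin Q (x + y) z = bilin Q x z + bilin Q y z.
Proof. by rewrite /bilin !mulmxDl mxE. Qed.

Lemma bilinDr (R : realType) n (Q : 'M[R]_n) x y z :
  bilin Q z (x + y) = bilin Q z x + bilin Q z y.
Proof. by rewrite /bilin linearD mulmxDr mxE. Qed.

Lemma bilinZl (R : realType) n (Q : 'M[R]_n) a x y :
  bilin Q (a *: x) y = a * bilin Q x y.
Proof. by rewrite /bilin -!scalemxAl mxE. Qed.

Lemma bilinZr (R : realType) n (Q : 'M[R]_n) a x y :
  bilin Q x (a *: y) = a * bilin Q x y.
Proof. by rewrite /bilin linearZ -scalemxAr mxE. Qed.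

Lemma bilinC (R : realType) n (Q : 'M[R]_n) x y :
  Q^T = Q -> bilin Q x y = bilin Q y x.
Proof.
by move=> sQ; rewrite /bilin -[RHS]trace_mx11 -mxtrace_tr !trmx_mul sQ trmxK mulmxA trace_mx11.
Qed.

Lemma bilin_delta (R : realType) n (Q : 'M[R]_n) i :
  bilin Q (delta_mx 0 i) (delta_mx 0 i) = Q i i.
Proof. by rewrite /bilin trmx_delta -rowE -colE !mxE. Qed.

Lemma continuous_sumr (R : realType) (T : topologicalType) (I : Type) (r : seq I)
    (F : I -> T -> R) :
  (forall i, continuous (F i)) -> continuous (fun x => \sum_(i <- r) F i x).
Proof.
move=> cF; apply: (@continuous_big R^o) => [|i _]; last exact: cF.
exact: (@add_continuous R^o).
Qed.

Lemma bilin_continuous (R : realType) n (Q : 'M[R]_n) :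
  continuous (fun x => bilin Q x x).
Proof.
have -> : (fun x => bilin Q x x) = (fun x => \sum_i \sum_j x 0 i * x 0 j * Q i j).
  by apply/funext => x; rewrite bilinE.
apply: continuous_sumr => i.
apply: continuous_sumr => j.
have cc k : continuous (fun x : 'rV[R]_n => x 0 k) by exact: coord_continuous.
have cM (f g : 'rV[R]_n -> R) :
    continuous f -> continuous g -> continuous (fun x => f x * g x).
  by move=> cf cg x; exact: (continuousM (cf x) (cg x)).
by apply: (cM); [exact: cM | exact: cst_continuous].
Qed.

(** The normalised part of the cone is a closed subset of a product of segments and singletons,
    hence compact. *)
Lemma face_min (R : realType) n (A : {set 'I_n}) (f : 'rV[R]_n -> R) :
  A != finset.set0 -> continuous f ->
  exists p, [/\ in_face A p, \sum_i p 0 i = 1 &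
    forall x, in_face A x -> \sum_i x 0 i = 1 -> f p <= f x].
Proof.
move=> /set0Pn [a Aa] cf.
pose B (i : 'I_n) : set R := (if i \in A then [set` `[0, 1]%R] else [set 0])%classic.
pose K : set 'rV[R]_n := [set v | forall i, B i (v ord0 i)]%classic.
pose H : set 'rV[R]_n := [set v | \sum_i v 0 i = 1]%classic.
have cK : compact K.
  apply: rV_compact => i; rewrite /B; case: ifP => _; first exact: segment_compact.
  exact: compact_set1.
have cH : closed H.
  apply: (@preimage_closed _ _ (fun v : 'rV[R]_n => \sum_i v 0 i) [set x | x = 1]%classic).
    move=> x _; apply: continuous_sumr => i.
    exact: coord_continuous.
  exact: closed_eq.
have faceP x : in_face A x -> \sum_i x 0 i = 1 -> (K `&` H)%classic x.
  move=> [x0 xA] s1; split => // i; rewrite /B; case: ifPn => iA /=; last exact: xA.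
  rewrite in_itv /= x0 /= -s1 (bigD1 i) //= lerDl; apply: sumr_ge0 => j _; exact: x0.
have [|||p] := @EVT_min_rV R n f (K `&` H).
- by exists (delta_mx 0 a); apply: faceP; [exact: in_face_delta | exact: sum_delta].
- apply: (subclosed_compact _ cK); last by move=> x [].
  by apply: closedI => //; apply: compact_closed => //; exact: norm_hausdorff.
- exact: continuous_subspaceT.
rewrite inE => -[Kp Hp] pmin; exists p; split => //.
  split=> i => [|/negbTE iA]; move: (Kp i); rewrite /B.
    by case: ifP => _ /=; [rewrite in_itv /= => /andP[] | move->].
  by rewrite iA.
by move=> x xA s1; apply: pmin; rewrite inE; exact: faceP.
Qed.

(** * Matrices with positive semidefinite principal blocks *)

(** The inductive step below, with [M = m - 1], [s = #|A| - 1], [t] the smallest coordinate of the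
    minimiser and [- nu] the minimum. Replacing [c] by its lower bound [- nu] leaves a multiple of
    the goal, up to the term [D], which is nonnegative because [t <= 1 / (s + 1)]. *)
Lemma locally_psd_step_arith (R : realFieldType) (M s t nu c : R) :
  1 <= M -> M + 1 <= s -> 0 <= t -> (s + 1) * t <= 1 -> 0 <= c + nu ->
  0 <= M * s * (- nu - 2 * t * c + t ^+ 2) + (s - (M + 1)) * (1 - t) ^+ 2 ->
  0 <= M * (s + 1) * - nu + (s - M).
Proof.
move=> M1 sM t0 ts cnu h.
have s1 : 0 < s by lra.
have t1 : 0 < 1 - 2 * t by nra.
have h1 : 0 <= M * s * (- nu + 2 * t * nu + t ^+ 2) + (s - (M + 1)) * (1 - t) ^+ 2.
  apply: (le_trans h); rewrite lerD2r ler_wpM2l //; first by nra.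
  nra.
have D : 0 <= (M + 1) * (1 - (s + 1) * t) * (1 + (s - 1) * t).
  apply: mulr_ge0; first by apply: mulr_ge0; lra.
  by apply: addr_ge0 => //; apply: mulr_ge0 => //; lra.
have : 0 <= s * (1 - 2 * t) * (M * (s + 1) * - nu + (s - M)).
  have -> : s * (1 - 2 * t) * (M * (s + 1) * - nu + (s - M)) =
    (s + 1) * (M * s * (- nu + 2 * t * nu + t ^+ 2) + (s - (M + 1)) * (1 - t) ^+ 2) +
    (M + 1) * (1 - (s + 1) * t) * (1 + (s - 1) * t) by ring.
  by apply: addr_ge0 => //; apply: mulr_ge0 => //; lra.
by rewrite pmulr_rge0 // mulr_gt0.
Qed.

(* Induction on [#|A|].  Let [x] minimise the form on the simplex of [A], with value [- nu],
   and let [j] be the smallest coordinate of [x], so that [x_j <= 1 / #|A|].  Moving from [x]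
   towards the vertex [j] shows [(x Q)_j >= - nu]; hence zeroing [x_j] gives a vector whose
   form is controlled from above by [nu], and from below by induction. *)
Lemma locally_psd_bound (R : realType) n m (Q : 'M[R]_n) :
  Q^T = Q -> (forall i, Q i i = 1) -> (0 < m)%N ->
  (forall A : {set 'I_n}, #|A| = m ->
     forall x : 'rV_n, (forall i, i \notin A -> x 0 i = 0) -> 0 <= bilin Q x x) ->
  forall (A : {set 'I_n}) p, (m <= #|A|)%N -> in_face A p ->
  0 <= m.-1%:R * #|A|%:R * bilin Q p p + (#|A| - m)%:R * (\sum_i p 0 i) ^+ 2.
Proof.
move=> sQ Q1 m0 psd A p mA.
elim: {A}_.+1 {-2}A (ltnSn #|A|) mA p => // N IH A AN mA p [p0 pA].
move: mA; rewrite leq_eqVlt => /orP[/eqP mA|mA].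
  rewrite -mA subnn mul0r addr0 mulr_ge0 ?mulr_ge0 ?ler0n //.
  exact: (psd A).
(* For [m = 1] the form has coefficient zero; afterwards [m - 1 >= 1], as the arithmetic step
   requires. *)
have [->|m1] := eqVneq m 1%N.
  by rewrite !mul0r add0r mulr_ge0 ?ler0n ?sqr_ge0.
have A0 : A != finset.set0 by rewrite -card_gt0; apply: leq_trans mA.
have [x [xA sx xmin]] := @face_min R n A _ A0 (@bilin_continuous R n Q).
have [a Aa] := set0Pn _ A0.
pose j := [arg min_(i < a in A) x 0 i]%O.
have [Aj jmin] : j \in A /\ forall i, i \in A -> x 0 j <= x 0 i.
  by rewrite /j; case: Order.TotalTheory.arg_minP.
pose e : 'rV[R]_n := delta_mx 0 j.
have se : \sum_i e 0 i = 1 := sum_delta R n j.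
have eA : in_face A e by exact: in_face_delta.
have bee : bilin Q e e = 1 by rewrite bilin_delta.
set nu := - bilin Q x x; set c := bilin Q x e; set t := x 0 j.
have t0 : 0 <= t := xA.1 j.
have cnu : 0 <= c + nu.
  rewrite leNgt; apply/negP => cn.
  (* Minimality of [x] against [(x + d e) / (1 + d)], cleared of denominators and divided by [d]. *)
  have lin d : 0 < d -> 0 <= 2 * (c + nu) + d * (1 + nu).
    move=> d0.
    have d1 : 0 < 1 + d by lra.
    have := xmin ((1 + d)^-1 *: (x + d *: e)).
    rewrite bilinZl bilinZr !bilinDl !bilinDr !bilinZl !bilinZr.
    rewrite (bilinC _ _ _ e x sQ) bee -/c -[bilin Q x x]opprK -/nu => /(_ _ _)/Wrap[].
    - apply: in_faceZ; first by rewrite invr_ge0 ltW.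
      by apply: in_faceD => //; apply: in_faceZ => //; exact: ltW.
    - have -> : \sum_i ((1 + d)^-1 *: (x + d *: e)) 0 i =
          (1 + d)^-1 * (\sum_i x 0 i + d * \sum_i e 0 i).
        by rewrite mulr_sumr -big_split mulr_sumr; apply: eq_bigr => i _; rewrite !mxE.
      by rewrite sx se mulr1 mulVf // gt_eqF.
    rewrite -subr_ge0 => h.
    have : 0 <= d * (2 * (c + nu) + d * (1 + nu)).
      have -> : d * (2 * (c + nu) + d * (1 + nu)) = (1 + d) ^+ 2 *
        ((1 + d)^-1 * ((1 + d)^-1 * (- nu + d * c + (d * c + d * (d * 1)))) - - nu).
        field; by rewrite gt_eqF.
      by rewrite mulr_ge0 ?sqr_ge0.
    by rewrite pmulr_rge0.
  (* If [1 + nu <= 0], then [d = 1] contradicts [c + nu < 0]; otherwise [d = - (c + nu) / (1 + nu)]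
     reduces [lin] to [0 <= c + nu]. *)
  have [nu1|nu1] := lerP (1 + nu) 0.
    by have := lin 1 ltr01; lra.
  have := lin (- (c + nu) / (1 + nu)) _; rewrite divfK ?gt_eqF //.
  move=> h; have : 0 <= c + nu by move: h => /(_ _)/Wrap[]; [rewrite divr_gt0 // oppr_gt0|lra].
  lra.
have key : 0 <= m.-1%:R * #|A|%:R * - nu + (#|A| - m)%:R.
  have cA : #|A| = #|A :\ j|.+1 by rewrite (cardsD1 j) Aj.
  have ms : (m <= #|A :\ j|)%N by rewrite -ltnS -cA.
  have m2 : (1 < m)%N by case: (m) m0 m1 => [|[]].
  have e1 : (m%:R : R) = m.-1%:R + 1 by rewrite -[in LHS](prednK m0) -natr1.
  rewrite natrB ?(ltnW mA) // cA -natr1.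
  have -> : (#|A :\ j|%:R + 1 - m%:R : R) = #|A :\ j|%:R - m.-1%:R by rewrite e1; ring.
  apply: (@locally_psd_step_arith R _ _ t nu c) => //.
  - by rewrite -(ler_nat R) in m2 *; rewrite e1 in m2; lra.
  - by rewrite -e1 ler_nat.
  - rewrite natr1 -cA -[leRHS]sx (bigID [in A]) /= [X in _ + X]big1 ?addr0; last by move=> i /xA.2.
    rewrite -sumr_const mulr_suml; apply: ler_sum => i iA; rewrite mul1r; exact: jmin.
  - have := IH (A :\ j) _ ms (x - t *: e).
    rewrite natrB // e1 => /(_ _ _)/Wrap[]//.
    + by rewrite -ltnS -cA.
    + split=> i.
        rewrite !mxE; have [->|ij] := eqVneq i j; first by rewrite mulr1 subrr.
        by rewrite mulr0 subr0 xA.1.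
      rewrite !inE negb_and negbK !mxE.
      have [->|ij] /= := eqVneq i j; first by rewrite mulr1 subrr.
      by move=> /xA.2 ->; rewrite mulr0 subr0.
    have -> : \sum_i (x - t *: e) 0 i = 1 - t.
      rewrite -sx -[t in RHS]mulr1 -se mulr_sumr -sumrB.
      by apply: eq_bigr => i _; rewrite !mxE.
    rewrite -scaleNr !bilinDl !bilinDr !bilinZl !bilinZr (bilinC _ _ _ e x sQ) bee -/c.
    rewrite -[bilin Q x x]opprK -/nu.
    by rewrite (_ : - nu + _ + _ = - nu - 2 * t * c + t ^+ 2) //; ring.
set S := \sum_i p 0 i.
have S0 : 0 <= S by apply: sumr_ge0.
(* Homogeneity of degree two carries the minimum on the normalised face over to [p]. *)
have : S ^+ 2 * - nu <= bilin Q p p.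
  have [Sz|Sz] := eqVneq S 0.
    have -> : p = 0.
      apply/rowP => i; rewrite mxE; apply/eqP.
      by move/eqP: Sz; rewrite psumr_eq0 // => /allP /(_ i (mem_index_enum i)).
    by rewrite Sz expr0n mul0r /bilin !mul0mx mxE.
  have := xmin (S^-1 *: p) => /(_ _ _)/Wrap[].
  - by apply: in_faceZ => //; rewrite invr_ge0.
  - have -> : \sum_i (S^-1 *: p) 0 i = S^-1 * S.
      by rewrite mulr_sumr; apply: eq_bigr => i _; rewrite mxE.
    by rewrite mulVf.
  rewrite bilinZl bilinZr /nu opprK => h.
  have -> : bilin Q p p = S ^+ 2 * (S^-1 * (S^-1 * bilin Q p p)) by field.
  by rewrite ler_wpM2l ?sqr_ge0.
move=> h; apply: (@le_trans _ _ (S ^+ 2 * (m.-1%:R * #|A|%:R * - nu + (#|A| - m)%:R))).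
  by rewrite mulr_ge0 ?sqr_ge0.
have : m.-1%:R * #|A|%:R * (S ^+ 2 * - nu) <= m.-1%:R * #|A|%:R * bilin Q p p.
  by rewrite ler_wpM2l // mulr_ge0 ?ler0n.
by nra.
Qed.

(** * Euclidean inequalities *)

Definition dot {R : realType} {n : nat} (x y : 'rV[R]_n) : R := (x *m y^T) 0 0.

Lemma dotE (R : realType) n (x y : 'rV[R]_n) : dot x y = \sum_i x 0 i * y 0 i.
Proof. by rewrite /dot mxE; apply: eq_bigr => i _; rewrite mxE. Qed.

Lemma dot_ge0 (R : realType) n (x : 'rV[R]_n) : 0 <= dot x x.
Proof. by rewrite dotE sumr_ge0 // => i _; rewrite -expr2 sqr_ge0. Qed.

(** Lagrange's identity: the squared 2 by 2 minors add up to twice the defect. *)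
Lemma cauchy_schwarz (R : realType) n (x y : 'rV[R]_n) :
  dot x y ^+ 2 <= dot x x * dot y y.
Proof.
have : 0 <= \sum_i \sum_j (x 0 i * y 0 j - x 0 j * y 0 i) ^+ 2.
  by apply: sumr_ge0 => i _; apply: sumr_ge0 => j _; exact: sqr_ge0.
have -> : \sum_i \sum_j (x 0 i * y 0 j - x 0 j * y 0 i) ^+ 2 =
    2 * (dot x x * dot y y - dot x y ^+ 2).
  transitivity (dot x x * dot y y + dot y y * dot x x - 2 * (dot x y * dot x y)).
    rewrite !dotE !big_distrlr /= mulr_sumr -big_split -sumrB /=.
    apply: eq_bigr => i _; rewrite mulr_sumr -big_split -sumrB /=.
    by apply: eq_bigr => j _; ring.
  ring.
by rewrite pmulr_rge0 ?subr_ge0 ?ltr0n.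
Qed.

(** The triangle inequality for plane vectors [(q i, b i)] of length [z i]. Expanding the squares
    reduces it to Cauchy-Schwarz for each pair [i], [j]. *)
Lemma minkowski2 (R : realType) n (q b z : 'I_n -> R) :
  (forall i, 0 <= z i) -> (forall i, q i ^+ 2 + b i ^+ 2 = z i ^+ 2) ->
  (\sum_i q i) ^+ 2 + (\sum_i b i) ^+ 2 <= (\sum_i z i) ^+ 2.
Proof.
move=> z0 zE; rewrite !expr2 !big_distrlr -big_split /=.
apply: ler_sum => i _; rewrite -big_split /=; apply: ler_sum => j _.
apply: le_trans (ler_norm _) _; rewrite -ler_sqr ?nnegrE ?mulr_ge0 //.
rewrite real_normK ?num_real // exprMn -!zE -subr_ge0.
have -> : (q i ^+ 2 + b i ^+ 2) * (q j ^+ 2 + b j ^+ 2) - (q i * q j + b i * b j) ^+ 2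
  = (q i * b j - b i * q j) ^+ 2 by ring.
exact: sqr_ge0.
Qed.

(** * Balls meeting the face spans *)

Lemma card_subset_with (T : finType) (x : T) m :
  (0 < m <= #|T|)%N -> exists A : {set T}, x \in A /\ #|A| = m.
Proof.
move=> /andP[m0 mT].
have xe : x \in enum T by rewrite mem_enum.
have sz : size (x :: rem x (enum T)) = #|T|.
  by rewrite /= size_rem // -cardE prednK // (leq_trans m0).
have un : uniq (x :: rem x (enum T)).
  by rewrite /= rem_uniq ?enum_uniq // mem_rem_uniq ?enum_uniq // !inE eqxx.
exists [set y in take m (x :: rem x (enum T))]; split.
  by rewrite inE; case: m m0 {mT} => //= m _; rewrite inE eqxx.
rewrite cardsE; move/card_uniqP: (take_uniq m un) => ->.
by rewrite size_takel // sz.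
Qed.

(* [rho'] is kept strictly above [rho] to make the diagonal of [N] positive, hence
   normalisable. *)
Lemma touching_bound (R : realType) d n m (G : 'M[R]_(d, n)) (b : 'rV[R]_n) (rho rho' : R) :
  (0 < m <= n)%N -> 0 <= rho < rho' ->
  \sum_i b 0 i = 1 -> (forall j, \sum_i G j i = 0) ->
  (forall i, exists j, G j i != 0) ->
  (forall T : {set 'I_n}, #|T| = m -> exists u : 'rV[R]_d,
     dot u u <= rho ^+ 2 /\ forall i, i \in T -> b 0 i + (u *m G) 0 i = 0) ->
  m%:R * (n%:R - 1) <=
    (n - m)%:R * (rho' * \sum_i Num.sqrt (\sum_j G j i ^+ 2)) ^+ 2.
Proof.
move=> /andP[m0 mn] /andP[rho0 rho_lt] b1 G0 Gn0 touch.
have sq_lt : rho ^+ 2 < rho' ^+ 2 by rewrite ltr_pXn2r ?nnegrE // (le_trans rho0) ?ltW.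
(* [u] leads from the centre to a point where the coordinates in [T] vanish. For [y] supported on
   [T] this turns [dot y b] into [- dot u (y *m G^T)], and Cauchy-Schwarz applies. *)
have psd0 (T : {set 'I_n}) (y : 'rV[R]_n) : #|T| = m -> (forall i, i \notin T -> y 0 i = 0) ->
    dot y b ^+ 2 <= rho ^+ 2 * dot (y *m G^T) (y *m G^T).
  move=> cT yT; have [u [uu uT]] := touch T cT.
  have -> : dot y b = - dot u (y *m G^T).
    rewrite {2}/dot trmx_mul trmxK mulmxA -/(dot (u *m G) y) !dotE -sumrN.
    apply: eq_bigr => i _; have [iT|/yT ->] := boolP (i \in T); last by rewrite mulr0 mul0r oppr0.
    by move/eqP: (uT i iT); rewrite addr_eq0 => /eqP ->; rewrite mulrC mulNr.
  rewrite sqrrN; apply: le_trans (cauchy_schwarz _ _ _ _) _.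
  by rewrite ler_wpM2r ?dot_ge0.
pose N : 'M[R]_n := rho' ^+ 2 *: (G^T *m G) - b^T *m b.
have NE y : bilin N y y = rho' ^+ 2 * dot (y *m G^T) (y *m G^T) - dot y b ^+ 2.
  rewrite /bilin mulmxBr mulmxBl mxE -scalemxAr -scalemxAl mxE; congr (_ * _ + _).
    by rewrite /dot trmx_mul trmxK !mulmxA.
  rewrite mxE !mulmxA -(mulmxA (y *m b^T)) mxE big_ord1 expr2 -/(dot y b).
  by congr (- (_ * _)); rewrite -/(dot b y) !dotE; apply: eq_bigr => i _; rewrite mulrC.
have Gpos i : 0 < \sum_j G j i ^+ 2.
  have [j Gj] := Gn0 i; rewrite (bigD1 j) //=; apply: ltr_pwDl.
    by rewrite lt_def sqrf_eq0 Gj sqr_ge0.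
  by apply: sumr_ge0 => l _; exact: sqr_ge0.
have dG i : dot (delta_mx 0 i *m G^T) (delta_mx 0 i *m G^T) = \sum_j G j i ^+ 2.
  by rewrite dotE -rowE; apply: eq_bigr => j _; rewrite !mxE expr2.
have db i : dot (delta_mx 0 i) b = b 0 i by rewrite /dot -rowE !mxE.
have Ndiag i : N i i = rho' ^+ 2 * (\sum_j G j i ^+ 2) - b 0 i ^+ 2.
  by rewrite -bilin_delta NE dG db.
have Npos i : 0 < N i i.
  have [|T [iT cT]] := @card_subset_with 'I_n i m; first by rewrite m0 card_ord.
  have := psd0 T (delta_mx 0 i) cT; rewrite dG db => /(_ _)/Wrap[].
    exact: (@in_face_delta R n T i iT).2.
  move=> h; rewrite Ndiag subr_gt0; apply: (le_lt_trans h); by rewrite ltr_pM2r.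
have sN : N^T = N by rewrite /N linearB linearZ /= !trmx_mul !trmxK.
have Nsym i j : N j i = N i j by have /matrixP/(_ i j) := sN; rewrite mxE.
clearbody N.
pose q : 'rV[R]_n := \row_i Num.sqrt (N i i).
have qpos i : 0 < q 0 i by rewrite mxE sqrtr_gt0.
have qsq i : q 0 i ^+ 2 = N i i by rewrite mxE sqr_sqrtr // ltW.
clearbody q.
pose Q : 'M[R]_n := \matrix_(i, j) (N i j / (q 0 i * q 0 j)).
have QE x : bilin Q x x = bilin N (\row_i (x 0 i / q 0 i)) (\row_i (x 0 i / q 0 i)).
  rewrite !bilinE; apply: eq_bigr => i _; apply: eq_bigr => j _; rewrite !mxE.
  by rewrite invfM; ring.
have := @locally_psd_bound R n m Q _ _ m0 _ [set: 'I_n] q.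
rewrite cardsT card_ord => /(_ _ _ _ mn _)/Wrap[].
- by apply/matrixP => i j; rewrite !mxE Nsym [q 0 j * _]mulrC.
- by move=> i; rewrite mxE -expr2 qsq divff // gt_eqF.
- move=> T cT x xT; rewrite QE NE subr_ge0; apply: (le_trans (psd0 T _ cT _)).
    by move=> i iT; rewrite mxE xT // mul0r.
  by rewrite ler_wpM2r ?dot_ge0 // ltW.
- by split=> i; [exact: ltW | rewrite inE].
(* Undoing the rescaling at [q] gives the all-ones vector: [G^T] kills it and its product with [b]
   is [1]. *)
have -> : bilin Q q q = -1.
  have -> : bilin Q q q = bilin N (const_mx 1) (const_mx 1).
    rewrite QE; congr (bilin N _ _); apply/rowP => i;
      by rewrite !mxE divff // gt_eqF.
  rewrite NE; have -> : const_mx 1 *m G^T = 0 :> 'rV[R]_d.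
    by apply/rowP => j; rewrite !mxE -[RHS](G0 j); apply: eq_bigr => i _; rewrite !mxE mul1r.
  have -> : dot (const_mx 1) b = 1.
    by rewrite dotE -[RHS]b1; apply: eq_bigr => i _; rewrite mxE mul1r.
  by rewrite /dot mul0mx mxE; ring.
have rho'0 : 0 <= rho' by rewrite (le_trans rho0) ?ltW.
have := @minkowski2 R n (fun i => q 0 i) (fun i => b 0 i)
  (fun i => rho' * Num.sqrt (\sum_j G j i ^+ 2)) _ _.
rewrite b1 -mulr_sumr => /(_ _ _)/Wrap[].
- by move=> i; rewrite mulr_ge0 ?sqrtr_ge0.
- by move=> i; rewrite qsq Ndiag exprMn sqr_sqrtr ?(ltW (Gpos i)) //; ring.
set L2 := (rho' * _) ^+ 2; set S2 := (\sum_i _) ^+ 2 => hS h.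
have nm : ((n - m)%:R : R) = n%:R - m%:R by rewrite natrB.
have mE : (m%:R : R) = m.-1%:R + 1 by rewrite -[in LHS](prednK m0) -natr1.
(* [h] gives [(m - 1) n <= (n - m) S2]; adding [n - m] makes the left side [m (n - 1)]. *)
have : (n - m)%:R * (S2 + 1 ^+ 2) <= (n - m)%:R * L2 by rewrite ler_wpM2l ?ler0n.
apply: le_trans.
move: h; rewrite nm mE; lra.
Qed.

(** * Barycentric coordinates as affine functions *)

(** The square matrix with rows [(1, v i)] is invertible by affine independence. The top row of its
    inverse is [w], the coordinates of the origin; the other rows form [G], whose columns are the
    gradients. *)
Lemma barycentric (R : realType) n (v : 'I_n.+1 -> 'rV[R]_n) :
  (0 < n)%N -> aff_indep v ->
  exists (w : 'rV[R]_n.+1) (G : 'M[R]_(n, n.+1)),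
    [/\ forall a y, \sum_i a i = 1 -> y = \sum_i a i *: v i ->
          forall i, a i = (w + y *m G) 0 i,
        \sum_i w 0 i = 1,
        forall j, \sum_i G j i = 0 &
        forall i, exists j, G j i != 0].
Proof.
move=> n0 vind.
pose V : 'M[R]_(n.+1, 1 + n) := row_mx (const_mx 1) (\matrix_i v i).
have mulV (a : 'rV[R]_n.+1) : a *m V = row_mx (\sum_i a 0 i)%:M (\sum_i a 0 i *: v i).
  rewrite mul_mx_row; congr row_mx.
    apply/rowP => i; rewrite !mxE ord1 eqxx mulr1n; apply: eq_bigr => j _; by rewrite mxE mulr1.
  by rewrite mulmx_sum_row; apply: eq_bigr => i _; rewrite rowK.
have Vu : (V : 'M_n.+1) \in unitmx.
  rewrite -row_free_unit -kermx_eq0; apply/rowV0P => a /sub_kermxP.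
  rewrite mulV => av0; have [/matrixP/(_ 0 0)]
    := @eq_row_mx _ 1 1 n _ _ _ _ (etrans av0 (esym (row_mx0 R 1 1 n))).
  rewrite !mxE eqxx mulr1n => sa va; apply/rowP => i; rewrite mxE; exact: (vind (fun i => a 0 i)).
pose W : 'M[R]_(1 + n, n.+1) := invmx (V : 'M_n.+1).
have VW : V *m W = 1%:M by exact: (mulmxV Vu).
have WV : W *m V = 1%:M by exact: (mulVmx Vu).
have coord a y : \sum_i a i = 1 -> y = \sum_i a i *: v i ->
    forall i, a i = (usubmx W + y *m dsubmx W) 0 i.
  move=> a1 yE i; rewrite -[usubmx W]mul1mx -mul_row_col vsubmxK.
  have -> : row_mx 1%:M y = (\row_i a i) *m V.
    rewrite mulV yE -a1; congr row_mx; [congr (_%:M)|]; apply: eq_bigr => j _; by rewrite mxE.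
  by rewrite -mulmxA VW mulmx1 mxE.
exists (usubmx W), (dsubmx W); split => //.
- have := congr1 (fun M : 'M_(1 + n) => M (lshift n 0) (lshift n 0)) WV.
  rewrite !mxE eqxx mulr1n => <-; apply: eq_bigr => i _.
  by rewrite row_mxEl !mxE mulr1.
- move=> j; have := congr1 (fun M : 'M_(1 + n) => M (rshift 1 j) (lshift n 0)) WV.
  rewrite !mxE eq_rlshift mulr0n => E0; rewrite -[RHS]E0; apply: eq_bigr => i _.
  by rewrite row_mxEl !mxE mulr1.
(* A zero gradient would make the [i]-th coordinate constant, although it is [1] at vertex [i] and
   [0] at any other. *)
move=> i; apply/existsP; apply: contraT => /existsPn Gz.
have dl l : (l == i)%:R = usubmx W 0 i.
  have -> : usubmx W 0 i = (usubmx W + v l *m dsubmx W) 0 i.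
    rewrite [RHS]mxE [X in _ + X]mxE big1 ?addr0 // => j _.
    by move/eqP: (negbNE (Gz j)) => ->; rewrite mulr0.
  rewrite eq_sym; apply: (coord (fun i => (i == l)%:R)).
    by rewrite (bigD1 l) //= eqxx big1 ?addr0 // => j /negbTE ->.
  rewrite (bigD1 l) //= eqxx scale1r big1 ?addr0 // => j /negbTE ->; by rewrite scale0r.
have := dl i; rewrite eqxx -(dl (lift i (Ordinal n0))) eq_sym (negbTE (neq_lift _ _)).
by move/eqP; rewrite oner_eq0.
Qed.

(** * Assembling the bound *)

Theorem theorem5p2 (R : realType) (n : nat) (v : 'I_n -> 'rV[R]_(n.-1)) (r : R)
  (k : nat) :
  (2 <= n)%N -> aff_indep v -> is_inradius v r -> (1 <= k <= n)%N ->
  forall (c : 'rV[R]_(n.-1)) (rho : R),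
    (forall S : {set 'I_n}, #|S| = k ->
       exists y, aff_span v S y /\ cball c rho y) ->
    Num.sqrt ((n.-1)%:R * (n - k)%:R / k%:R) * r <= rho.
Proof.
(* From here on [n] is the dimension and there are [n.+1] vertices. *)
case: n v => [//|n] v n2 vind [[c0 c0P] _] /andP[k0 kn] c rho touch.
have [w [G [coord w1 G0 Gn0]]] := @barycentric R n v n2 vind.
have rho0 : 0 <= rho.
  have [|S [_ cS]] := @card_subset_with 'I_n.+1 ord0 k; first by rewrite k0 card_ord.
  by have [y [_ /(le_trans (sqrtr_ge0 _))]] := touch S cS.
have [r0|r0] := lerP r 0.
  by apply: le_trans rho0; rewrite mulr_ge0_le0 ?sqrtr_ge0.
move: kn; rewrite leq_eqVlt => /orP[/eqP ->|kn].
  by rewrite subnn mulr0 mul0r sqrtr0 mul0r.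
pose s i := Num.sqrt (\sum_j G j i ^+ 2).
have spos i : 0 < s i.
  rewrite sqrtr_gt0; have [j Gj] := Gn0 i; rewrite (bigD1 j) //=; apply: ltr_pwDl.
    by rewrite lt_def sqrf_eq0 Gj sqr_ge0.
  by apply: sumr_ge0 => l _; exact: sqr_ge0.
have ssq i : s i ^+ 2 = \sum_j G j i ^+ 2.
  by rewrite sqr_sqrtr // sumr_ge0 // => j _; exact: sqr_ge0.
have sum1 y : \sum_i (w + y *m G) 0 i = 1.
  rewrite -[RHS]w1 -[RHS]addr0 (eq_bigr _ (fun i _ => mxE _ _ _ i)) big_split /=.
  congr (_ + _); rewrite (eq_bigr _ (fun i _ => mxE _ _ _ i)) exchange_big big1 //= => j _.
  by rewrite -mulr_sumr G0 mulr0.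
(* Moving from [c0] by [r] against the [i]-th gradient stays in the simplex and lowers the [i]-th
   coordinate by [r * s i], so that coordinate of [c0] is at least [r * s i]. Sum over [i]. *)
have rL : r * \sum_i s i <= 1.
  rewrite -(sum1 c0) mulr_sumr; apply: ler_sum => i _.
  pose y := c0 - (r / s i) *: (col i G)^T.
  have [|a [a0 [a1 yE]]] := c0P y.
    rewrite /cball /edist -[leRHS]ger0_norm ?(ltW r0) // -sqrtr_sqr ler_sqrt ?sqr_ge0 //.
    have -> : \sum_j (c0 0 j - y 0 j) ^+ 2 = (r / s i) ^+ 2 * s i ^+ 2.
      rewrite ssq mulr_sumr; apply: eq_bigr => j _; rewrite !mxE; ring.
    by rewrite -exprMn divfK // gt_eqF.
  have := a0 i; rewrite (coord a y a1 yE i) mulmxBl addrA !mxE subr_ge0; apply: le_trans.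
  rewrite le_eqVlt; apply/orP; left; apply/eqP; transitivity (r / s i * s i ^+ 2).
    by field; rewrite gt_eqF.
  by rewrite ssq mulr_sumr; apply: eq_bigr => j _; rewrite !mxE; ring.
(* The slack [e] supplies the radius strictly above [rho]. *)
apply/ler_addgt0Pr => e e0.
have rho'0 : 0 <= rho + e by rewrite addr_ge0 // ltW.
have L0 : 0 <= \sum_i s i by apply: sumr_ge0 => i _; rewrite ltW.
have := @touching_bound R n n.+1 (n.+1 - k) G (w + c *m G) rho (rho + e) _ _ _ G0 Gn0 _.
move=> /(_ _ _ _ _)/Wrap[].
- by rewrite subn_gt0 kn leq_subr.
- by rewrite rho0 ltrDl.
- exact: sum1.
(* The complement of [T] has [k] vertices, and a point of its span has zero coordinates on [T]. *)
- move=> T cT; have [|y [[a [aS [a1 yE]]] yc]] := touch (~: T).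
    by rewrite cardsCs finset.setCK card_ord cT subKn // ltnW.
  exists (y - c); split.
    move: yc; rewrite /cball /edist -[leRHS]ger0_norm // -sqrtr_sqr ler_sqrt ?sqr_ge0 //.
    by apply: le_trans; rewrite dotE; apply: ler_sum => j _; rewrite !mxE -expr2 -sqrrN opprB.
  move=> i iT; rewrite mulmxBl; have := coord a y a1 yE i; rewrite aS ?inE ?iT //.
  by rewrite !mxE => E; rewrite [RHS]E; ring.
rewrite subKn ?(ltnW kn) // -natr1 addrK -/s => h.
have kR : 0 < (k%:R : R) by rewrite ltr0n.
have : Num.sqrt (n%:R * (n.+1 - k)%:R / k%:R) <= (rho + e) * \sum_i s i.
  rewrite -[leRHS]ger0_norm ?mulr_ge0 // -sqrtr_sqr ler_sqrt ?sqr_ge0 //.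
  by rewrite ler_pdivrMr // mulrC [leRHS]mulrC.
(* Multiplying by [r] and using [rL] bounds the right side by [rho + e]. *)
move/(ler_wpM2r (ltW r0)) => /le_trans; apply.
by rewrite -mulrA -[leRHS]mulr1 ler_wpM2l // mulrC.
Qed.
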